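(* The discrete generating function $\mathcal{S}_d(q_k,p_{k+1})$ of the rough Galerkin method, through $$p_k=\frac{\partial\mathcal{S}_d}{\partial q_k}(q_k,p_{k+1}),\qquad q_{k+1}=\frac{\partial\mathcal{S}_d}{\partial p_{k+1}}(q_k,p_{k+1}),$$ generates a discrete flow $(q_k,p_k)\mapsto(q_{k+1},p_{k+1})$ that preserves the symplectic form between time steps: $$\mathrm{d}p_k\wedge\mathrm{d}q_k=\mathrm{d}p_{k+1}\wedge\mathrm{d}q_{k+1}.$$
   Context: Let $\mathbf{Z}$ be a geometric $\alpha$-Hölder rough path in $\mathbb{R}^K$ over $[t_0,t_1]$, $\alpha\in(\frac13,\frac12]$, with increment $Z_{t_k,t_{k+1}}=Z_{t_{k+1}}-Z_{t_k}\in\mathbb{R}^K$ on a step $[t_k,t_{k+1}]$ of length $\Delta t$. Let $H\in C^\infty(\mathbb{R}^N\times\mathbb{R}^N,\mathbb{R})$ and $\mathcal{H}=(H_1,\dots,H_K)^T\in C^\infty(\mathbb{R}^N\times\mathbb{R}^N,\mathbb{R}^K)$, with $\mathcal{H}\cdot Z_{t_k,t_{k+1}}:=\sum_jH_jZ^j_{t_k,t_{k+1}}$. Rough Galerkin method: let $0=d_0<d_1<\dots<d_s=1$ be control points, $l_0,\dots,l_s$ the degree-$s$ Lagrange polynomials with $l_\mu(d_\nu)=\delta_{\mu\nu}$, and $$q_d(t_k+\eta\Delta t)=\sum_{\mu=0}^sq^\mu l_\mu(\eta),\qquad\dot q_d(t_k+\eta\Delta t)=\frac1{\Delta t}\sum_{\mu=0}^sq^\mu\dot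 l_\mu(\eta),\qquad q^\mu\in\mathbb{R}^N.$$ Let $0\le c_1\le\dots\le c_r\le1$ be quadrature points with weights $b_i$ (for $dt$) and $\bar b_i$ (for $d\mathbf{Z}$), $Q_{i,k}=q_d(t_k+c_i\Delta t)$, and let $P_{i,k}\in\mathbb{R}^N$, $i=1,\dots,r$, be free momentum values. Then $$\mathcal{S}_d(q_k,p_{k+1})=\underset{P_{i,k},\,q^\mu;\;q^0=q_k}{\mathrm{ext}}\Big[p_{k+1}q^s-\Delta t\sum_{i=1}^rb_i\big(P_{i,k}\dot q_d(t_k+c_i\Delta t)-H(Q_{i,k},P_{i,k})\big)+\sum_{i=1}^r\bar b_i\mathcal{H}(Q_{i,k},P_{i,k})\cdot Z_{t_k,t_{k+1}}\Big],$$ where ext denotes the stationary value over $q^1,\dots,q^s$ and $P_{1,k},\dots,P_{r,k}$. Standing assumption: the method is solvable, i.e. the stationarity conditions determine $q^\mu,P_{i,k}$ as smooth functions of $(q_k,p_{k+1})$, $\mathcal{S}_d$ is smooth, and the two displayed relations define the map $(q_k,p_k)\mapsto(q_{k+1},p_{k+1})$ via the implicit function theorem. $\mathrm{d}p\wedge\mathrm{d}q=\sum_i\mathrm{d}p_i\wedge\mathrm{d}q^i$. *)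

(* Defs.v *)
From HB Require Import structures.
From mathcomp Require Import all_boot all_order all_algebra.
From mathcomp Require Import boolp classical_sets functions reals.
From mathcomp Require Import topology normedtype landau derive exp.

Set Implicit Arguments.
Unset Strict Implicit.
Unset Printing Implicit Defensive.

Import Order.TTheory GRing.Theory Num.Theory.
Import numFieldNormedType.Exports.

Local Open Scope classical_set_scope.
Local Open Scope ring_scope.

Section Smooth.
Context {R : realType} {V W : normedModType R}.

(* For open A and finite-dimensional V this is the usual class C^n(A): f is
   differentiable on A and all its directional derivatives are C^(n-1). *)
Fixpoint Cn_on (n : nat) (A : set V) (f : V -> W) : Prop :=
  match n with
  | 0%N => forall x, A x -> {for x, continuous f}
  | m.+1 => (forall x, A x -> differentiable f x) /\
            (forall v : V, Cn_on m A (fun x => 'd f x v))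
  end.

Definition smooth_on (A : set V) (f : V -> W) : Prop :=
  forall n, Cn_on n A f.

Definition stationary (f : V -> W) (x : V) : Prop :=
  differentiable f x /\ forall v, 'd f x v = 0.

End Smooth.

Section RoughPaths.
Context {R : realType} {K : nat}.
Implicit Types (Z : R -> 'rV[R]_K) (ZZ : R -> R -> 'M[R]_K).

Definition increment Z (u v : R) : 'rV[R]_K := Z v - Z u.

(* The entry (i, j) of ZZ u v stands for the iterated integral of
   (Z^i - Z^i_u) dZ^j over [u, v]. *)
Definition rough_path (alpha t0 t1 : R) Z ZZ : Prop :=
  [/\ exists C : R, forall u v, t0 <= u -> u <= v -> v <= t1 ->
        `|increment Z u v| <= C * (v - u) `^ alpha,
      exists C : R, forall u v, t0 <= u -> u <= v -> v <= t1 ->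
        `|ZZ u v| <= C * (v - u) `^ (2 * alpha)
    & forall u w v, t0 <= u -> u <= w -> w <= v -> v <= t1 ->
        ZZ u v - ZZ u w - ZZ w v = (increment Z u w)^T *m increment Z w v].

(* "Geometric" is the first-order calculus identity
   Sym ZZ = (1/2) Z (x) Z; every limit, in the rough path metric, of canonical
   lifts of smooth paths satisfies it. *)
Definition geometric_rough_path (alpha t0 t1 : R) Z ZZ : Prop :=
  rough_path alpha t0 t1 Z ZZ /\
  forall u v, t0 <= u -> u <= v -> v <= t1 ->
    2^-1 *: (ZZ u v + (ZZ u v)^T) =
    2^-1 *: ((increment Z u v)^T *m increment Z u v).

End RoughPaths.

Section Galerkin.
Context {R : realType} {N K s r : nat}.

Definition dot n (x y : 'rV[R]_n) : R := \sum_i x 0 i * y 0 i.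

Definition control_points (d : 'I_s.+1 -> R) : Prop :=
  [/\ d ord0 = 0, d ord_max = 1 &
      forall mu nu : 'I_s.+1, (mu < nu)%N -> d mu < d nu].

Definition quadrature_points (c : 'I_r -> R) : Prop :=
  (forall i, 0 <= c i <= 1) /\
  (forall i j : 'I_r, (i <= j)%N -> c i <= c j).

Definition lagrange_poly (d : 'I_s.+1 -> R) (mu : 'I_s.+1) : {poly R} :=
  \prod_(nu | nu != mu) ((d mu - d nu)^-1 *: ('X - (d nu)%:P)).

Lemma lagrange_poly_delta (d : 'I_s.+1 -> R) (mu nu : 'I_s.+1) :
  control_points d -> (lagrange_poly d mu).[d nu] = (mu == nu)%:R.
Proof.
case=> _ _ dlt; rewrite /lagrange_poly horner_prod.
have dinj i j : i != j -> d i - d j != 0.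
  rewrite -val_eqE neq_ltn subr_eq0 => /orP[] /dlt; last by rewrite lt_neqAle eq_sym => /andP[].
  by rewrite lt_neqAle => /andP[].
case: (eqVneq mu nu) => [<-|neq].
  by rewrite big1 // => i ni; rewrite hornerZ hornerXsubC mulVf // dinj // eq_sym.
by rewrite (bigD1 nu) 1?eq_sym //= hornerZ hornerXsubC subrr mulr0 mul0r.
Qed.

(* Rows of the first component: q^1, ..., q^s; rows of the second: the momenta
   P_1, ..., P_r. *)
Definition internal : normedModType R := ('M[R]_(s, N) * 'M[R]_(r, N))%type.

(* q^0 = q_k is prescribed, the other q^mu are free. *)
Definition control_value (qk : 'rV[R]_N) (x : internal) (mu : 'I_s.+1)
  : 'rV[R]_N :=
  if unlift ord0 mu is Some j then row j x.1 else qk.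

(* The values of q_d and of its time derivative at t_k + eta * dt. *)
Definition q_d (d : 'I_s.+1 -> R) (qk : 'rV[R]_N) (x : internal) (eta : R)
  : 'rV[R]_N :=
  \sum_mu (lagrange_poly d mu).[eta] *: control_value qk x mu.

Definition dot_q_d (dt : R) (d : 'I_s.+1 -> R) (qk : 'rV[R]_N) (x : internal)
  (eta : R) : 'rV[R]_N :=
  dt^-1 *: \sum_mu ((lagrange_poly d mu)^`()).[eta] *: control_value qk x mu.

(* The bracket whose stationary value over x is S_d(q_k, p_{k+1}), where
   z = (q_k, p_{k+1}) and dZ is the increment of Z over the step. *)
Definition galerkin_action
  (H : 'rV[R]_N * 'rV[R]_N -> R) (HH : 'rV[R]_N * 'rV[R]_N -> 'rV[R]_K)
  (d : 'I_s.+1 -> R) (c b bbar : 'I_r -> R) (dt : R) (dZ : 'rV[R]_K)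
  (z : 'rV[R]_N * 'rV[R]_N) (x : internal) : R :=
  dot z.2 (control_value z.1 x ord_max)
  - dt * (\sum_(i < r) b i *
      (dot (row i x.2) (dot_q_d dt d z.1 x (c i))
       - H (q_d d z.1 x (c i), row i x.2)))
  + \sum_(i < r) bbar i * dot (HH (q_d d z.1 x (c i), row i x.2)) dZ.

(* On U the stationary point in the open set W exists, is unique, and is the
   smooth function sol of (q_k, p_{k+1}). *)
Definition solvable_by (F : 'rV[R]_N * 'rV[R]_N -> internal -> R)
  (U : set ('rV[R]_N * 'rV[R]_N)) (W : set internal)
  (sol : 'rV[R]_N * 'rV[R]_N -> internal) : Prop :=
  [/\ open U, open W, smooth_on U sol &
      forall z, U z -> forall x, (W x /\ stationary (F z) x) <-> x = sol z].

Definition stationary_value (F : 'rV[R]_N * 'rV[R]_N -> internal -> R)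
  (sol : 'rV[R]_N * 'rV[R]_N -> internal) (z : 'rV[R]_N * 'rV[R]_N) : R :=
  F z (sol z).

End Galerkin.

Arguments internal : clear implicits.

Section GeneratingFunctions.
Context {R : realType} {N : nat}.
Local Notation E := ('rV[R]_N * 'rV[R]_N)%type.

(* Partial gradients of S(q, p). *)
Definition grad_q (S : E -> R) (z : E) : 'rV[R]_N :=
  \row_i 'D_(delta_mx 0 i : 'rV[R]_N) (fun q => S (q, z.2)) z.1.

Definition grad_p (S : E -> R) (z : E) : 'rV[R]_N :=
  \row_i 'D_(delta_mx 0 i : 'rV[R]_N) (fun p => S (z.1, p)) z.2.

(* The relation p_k = dS/dq_k (q_k, p_{k+1}), solved for p_{k+1} by the smooth
   function nextp of (q_k, p_k) in V; U is the domain of S. *)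
Definition solves_momentum (S : E -> R) (U V : set E) (nextp : E -> 'rV[R]_N)
  : Prop :=
  [/\ open V, smooth_on V nextp &
      forall qk pk, V (qk, pk) -> forall pk1,
        (U (qk, pk1) /\ pk = grad_q S (qk, pk1)) <-> pk1 = nextp (qk, pk)].

Definition generates_flow (S : E -> R) (U V : set E) (Phi : E -> E) : Prop :=
  smooth_on V Phi /\
  forall qk pk, V (qk, pk) -> forall qk1 pk1,
    [/\ U (qk, pk1), pk = grad_q S (qk, pk1) & qk1 = grad_p S (qk, pk1)]
    <-> (qk1, pk1) = Phi (qk, pk).

(* The 2-form df /\ dg at z, evaluated on the tangent vectors u and v. *)
Definition wedge_d (f g : E -> R) (z u v : E) : R :=
  'd f z u * 'd g z v - 'd f z v * 'd g z u.

(* The 2-form \sum_i dp_i /\ dq^i for functions q, p of z. *)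
Definition dp_wedge_dq (q p : E -> 'rV[R]_N) (z u v : E) : R :=
  \sum_i wedge_d (fun y => p y 0 i) (fun y => q y 0 i) z u v.

End GeneratingFunctions.

(* Main.v *)
Require Import Defs.
From HB Require Import structures.
From mathcomp Require Import all_boot all_order all_algebra.
From mathcomp Require Import boolp classical_sets functions reals.
From mathcomp Require Import topology normedtype landau derive exp.
From mathcomp Require Import ring lra.

Set Implicit Arguments.
Unset Strict Implicit.
Unset Printing Implicit Defensive.

Import Order.TTheory GRing.Theory Num.Theory.
Import numFieldNormedType.Exports.

Local Open Scope classical_set_scope.
Local Open Scope ring_scope.

(** The map produced by a generating function S(q, P) of the mixed variables
    (q, P) is symplectic because the Hessian of S is symmetric, and the
    stationary value of the action is such an S.  Write Psi(q, p) =
    (q, P(q, p)) for the mixed point attached to an initial state, so that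
    p = dS/dq and Q = dS/dP are both taken at Psi(q, p), and let B be the
    Hessian of S there.  Differentiating these two relations gives, for tangent
    vectors u and v with q-parts u1 and v1,
      (dp /\ dq)(u, v) = B(Psi' u, (v1, 0)) - B(Psi' v, (u1, 0)),
      (dP /\ dQ)(u, v) = B(Psi' v, (0, P' u)) - B(Psi' u, (0, P' v)).
    Since Psi' u = (u1, P' u), the difference of the two lines is
    B(Psi' u, Psi' v) - B(Psi' v, Psi' u), which vanishes because the Hessian
    is symmetric ([diff2C], [generated_map_symplectic]).

    Two pieces of calculus carry this computation.  The symmetry of the
    Hessian is proved in Young's form, from differentiability of the first
    directional derivatives at one point, by evaluating a second difference in
    two ways.  That the flow (q, p) |-> (Q, P) is smooth follows from the
    stability of the classes C^n under sums, products and, through the chain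
    rule in linear coordinates, composition ([Cn_on_comp],
    [smooth_generated_map]). *)

(** * Local properties of the differential *)

Section LocalDifferential.
Context {R : realType} {V W : normedModType R}.

Lemma near_eq_is_diff (f g : V -> W) (x : V) :
  {near x, f =1 g} -> differentiable f x ->
  differentiable g x /\ 'd g x = 'd f x :> (V -> W).
Proof.
move=> fg df.
have [cf /eqaddoP ef] := (diff_locallyP x f).1 df.
have eg : g \o shift x = cst (g x) + 'd f x +o_ 0 id.
  apply/eqaddoP => e e0; have {ef}ef := ef _ e0.
  have fgx : f x = g x by exact: nbhs_singleton fg.
  move: fg; rewrite (near_shift 0) subr0 => fg.
  near=> h.
  rewrite -[X in `|X|]/(g (h + x) - (g x + 'd f x h)) -fgx.
  have -> : g (h + x) = f (h + x) by apply/esym; near: h.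
  by near: h.
have dgf : 'd g x = 'd f x :> (V -> W) by apply: diff_unique.
split; last exact: dgf.
by apply/diff_locallyP; rewrite dgf; exact: conj cf eg.
Unshelve. all: by end_near. Qed.

Lemma diff_norm_le (f : V -> W) (x : V) (e : R) :
  differentiable f x -> 0 < e ->
  \forall h \near 0, `|f (h + x) - f x - 'd f x h| <= e * `|h|.
Proof.
move=> /diff_locallyP [_ /eqaddoP ef] e0.
apply: filterS (ef e e0) => h.
by rewrite -[X in `|X|]/(f (h + x) - (f x + 'd f x h)) opprD addrA.
Qed.

End LocalDifferential.

(** * Symmetry of second derivatives *)

Section Young.
Context {R : realType} {V : normedModType R}.
Implicit Types (f : V -> R) (x u v : V).

Lemma is_derive_line f u w (s : R) : differentiable f (s *: u + w) ->
  is_derive s 1 (fun a => f (a *: u + w)) ('d f (s *: u + w) u).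
Proof.
move=> df.
have [dl lE] : is_diff s (fun a : R => a *: u + w) ( *:%R^~ u + 0).
  exact: (@is_diffD _ _ _ _ _ _ _ s (is_diff_scalel s u) (is_diff_cst w s)).
have dfl := differentiable_comp dl df.
apply: DeriveDef; first exact: diff_derivable.
rewrite deriveE // (diff_comp dl df) /= lE.
by congr ('d f _ _); rewrite -[LHS]/(1 *: u + 0) addr0 scale1r.
Qed.

(** The second difference is g(t) - g(0) for the increment
    g(s) = f(x + s u + t v) - f(x + s u).  The mean value theorem makes it
    t g'(s), and expanding y |-> 'd f y u to first order at x turns g'(s) into
    t 'd ('d f . u) x v up to an error small compared with t.  The expression
    approximated is symmetric in u and v, the approximation is not: this is
    what [diff2C] exploits. *)
Lemma second_difference_approx f x u v (e : R) :
  (\forall y \near x, differentiable f y) ->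
  differentiable (fun y => 'd f y u) x -> 0 < e ->
  \forall t \near 0^'+,
    `|f (t *: u + t *: v + x) - f (t *: u + x) - f (t *: v + x) + f x
      - t ^+ 2 * 'd (fun y => 'd f y u) x v| <= e * t ^+ 2.
Proof.
move=> df d2f e0; set L := 'd _ x.
(* The points x + s u + t v and x + s u with 0 <= s <= t lie within t M of x,
   and the sum of their distances to x is at most t M; adding 1 keeps M
   positive when u = v = 0. *)
pose M := `|u| + `|v| + `|u| + 1.
have M0 : 0 < M by rewrite /M ltr_wpDl // !addr_ge0.
have := diff_norm_le d2f (divr_gt0 e0 M0); rewrite -/L.
move/nbhs_norm0P => [/= d1 d10 near1].
move: df; rewrite (near_shift 0) subr0 => /nbhs_norm0P [/= d2 d20 near2].
near=> t.
have t0 : 0 < t by near: t; exact: nbhs_right_gt.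
have [tM1 tM2] : t * M < d1 /\ t * M < d2.
  by split; rewrite -ltr_pdivlMr //; near: t; apply: nbhs_right_lt; rewrite divr_gt0.
have hu s : 0 <= s <= t -> `|s *: u| <= t * `|u|.
  move=> /andP[s0 st]; rewrite normrZ ger0_norm //.
  by rewrite ler_wpM2r.
have huv s : 0 <= s <= t -> `|s *: u + t *: v| <= t * (`|u| + `|v|).
  move=> st; rewrite mulrDr (le_trans (ler_normD _ _)) // lerD //; first exact: hu.
  by rewrite normrZ gtr0_norm.
have small1 s : 0 <= s <= t -> `|s *: u| < t * M.
  move=> st; apply: le_lt_trans (hu _ st) _; rewrite ltr_pM2l // /M.
  have := normr_ge0 u; have := normr_ge0 v; lra.
have small2 s : 0 <= s <= t -> `|s *: u + t *: v| < t * M.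
  move=> st; apply: le_lt_trans (huv _ st) _; rewrite ltr_pM2l // /M.
  have := normr_ge0 u; have := normr_ge0 v; lra.
pose g s := f (s *: u + t *: v + x) - f (s *: u + x).
pose dg s := 'd f (s *: u + t *: v + x) u - 'd f (s *: u + x) u.
have gd s : 0 <= s <= t -> is_derive s 1 g (dg s).
  move=> st; rewrite /g /dg; apply: is_deriveB.
    rewrite -addrA; under eq_fun do rewrite -addrA.
    by apply: is_derive_line; rewrite addrA; apply: near2 => /=;
      apply: lt_trans tM2; exact: small2.
  by apply: is_derive_line; apply: near2 => /=; apply: lt_trans tM2; exact: small1.
have [s||s sI gE] := @MVT R g dg 0 t t0.
- by rewrite in_itv /= => /andP[/ltW ? /ltW ?]; apply: gd; apply/andP.
- apply: continuous_in_subspaceT => s; rewrite inE /= in_itv /= => st.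
  have [ds _] := gd s st.
  by apply/differentiable_continuous/derivable1_diffP.
move: sI; rewrite in_itv /= => /andP[/ltW s0 /ltW st].
have {}st : 0 <= s <= t by rewrite s0.
rewrite subr0 in gE.
have gtE : f (t *: u + t *: v + x) - f (t *: u + x) - f (t *: v + x) + f x =
    dg s * t.
  by rewrite -gE /g !scale0r !add0r; ring.
have N1 : `|'d f (s *: u + t *: v + x) u - 'd f x u - L (s *: u + t *: v)|
    <= e / M * (t * (`|u| + `|v|)).
  apply: le_trans (near1 _ _) _; first exact: lt_trans (small2 _ st) tM1.
  by rewrite ler_pM2l ?divr_gt0 // huv.
have N2 : `|'d f (s *: u + x) u - 'd f x u - L (s *: u)| <= e / M * (t * `|u|).
  apply: le_trans (near1 _ _) _; first exact: lt_trans (small1 _ st) tM1.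
  by rewrite ler_pM2l ?divr_gt0 // hu.
rewrite gtE.
have -> : dg s * t - t ^+ 2 * L v = t * (dg s - t * L v) by ring.
have -> : dg s - t * L v =
    ('d f (s *: u + t *: v + x) u - 'd f x u - L (s *: u + t *: v))
    - ('d f (s *: u + x) u - 'd f x u - L (s *: u)).
  by rewrite /dg linearD !linearZ /=; ring.
rewrite normrM gtr0_norm // expr2 mulrCA ler_pM2l //.
apply: le_trans (ler_normB _ _) _; apply: le_trans (lerD N1 N2) _.
have -> : e / M * (t * (`|u| + `|v|)) + e / M * (t * `|u|)
    = e * t * ((`|u| + `|v| + `|u|) / M) by ring.
rewrite [leRHS](_ : _ = e * t * 1); last by ring.
rewrite ler_pM2l ?mulr_gt0 // ler_pdivrMr // mul1r /M.
by rewrite lerDl.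
Unshelve. all: by end_near. Qed.

(** Young's theorem: both sides are the limit of the same second difference
    divided by t^2. *)
Lemma diff2C f x u v :
  (\forall y \near x, differentiable f y) ->
  differentiable (fun y => 'd f y u) x ->
  differentiable (fun y => 'd f y v) x ->
  'd (fun y => 'd f y u) x v = 'd (fun y => 'd f y v) x u.
Proof.
move=> df du dv; apply/eqP; rewrite -subr_eq0 -normr_le0; apply/ler_addgt0Pr => e e0.
rewrite add0r.
have e20 : 0 < e / 2 by rewrite divr_gt0.
have /filter_ex [t [[t0 A] B]] : \forall t \near (0 : R)^'+, (0 < t /\
  `|f (t *: u + t *: v + x) - f (t *: u + x) - f (t *: v + x) + f x
      - t ^+ 2 * 'd (fun y => 'd f y u) x v| <= e / 2 * t ^+ 2) /\
  `|f (t *: v + t *: u + x) - f (t *: v + x) - f (t *: u + x) + f x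
      - t ^+ 2 * 'd (fun y => 'd f y v) x u| <= e / 2 * t ^+ 2.
  apply: filterI; last exact: second_difference_approx.
  by apply: filterI; [exact: nbhs_right_gt | exact: second_difference_approx].
have t20 : 0 < t ^+ 2 by rewrite exprn_gt0.
rewrite -(ler_pM2l t20) -[X in X * `|_|]gtr0_norm // -normrM.
move: A B; rewrite [t *: v + t *: u]addrC.
rewrite !ler_norml => /andP[A1 A2] /andP[B1 B2].
apply/andP; split; lra.
Qed.

End Young.

(** * Stability of the classes C^n *)

Section CnTheory.
Context {R : realType}.
Implicit Types (V W : normedModType R).

(** Differentials at points of an open set only see the values on that set;
    this is what allows rewriting a derivative by a formula valid on A only. *)
Lemma eq_Cn_on V W n (A : set V) (f g : V -> W) : open A ->
  (forall x, A x -> f x = g x) -> Cn_on n A f -> Cn_on n A g.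
Proof.
move=> oA; have nA x : A x -> \near x, A x by move=> Ax; apply: open_nbhs_nbhs.
elim: n f g => [|n IH] f g fg /=.
  move=> cf x Ax; suff : g @ x --> f x by rewrite (fg x Ax).
  apply: cvg_trans (cf x Ax); apply: near_eq_cvg.
  by apply: filterS (nA x Ax).
move=> [df Cf].
have key x : A x -> differentiable g x /\ 'd g x = 'd f x :> (V -> W).
  by move=> Ax; apply: near_eq_is_diff (df x Ax); apply: filterS (nA x Ax).
split=> [x /key[]//|v].
by apply: IH (Cf v) => x /key[_ ->].
Qed.

Lemma Cn_onW V W n (A : set V) (f : V -> W) : Cn_on n.+1 A f -> Cn_on n A f.
Proof.
elim: n f => [|n IH] f [df Cf].
  by move=> x /df; exact: differentiable_continuous.
by split=> // v; apply: IH.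
Qed.

Lemma Cn_on_cst V W n (A : set V) (w : W) : Cn_on n A (fun _ => w).
Proof.
elim: n w => [|n IH] w /=; first by move=> x _; exact: cvg_cst.
split=> [x _|v]; first exact: differentiable_cst.
rewrite (_ : (fun x => _) = fun=> 0); first exact: IH.
by apply/funext => x; rewrite diff_cst.
Qed.

Lemma Cn_on_lin V W n (A : set V) (L : {linear V -> W}) :
  continuous L -> Cn_on n A L.
Proof.
move=> cL; case: n => [|n] /=; first by move=> x _; exact: cL.
split=> [x _|v]; first exact: linear_differentiable.
rewrite (_ : (fun x => _) = fun=> L v); first exact: Cn_on_cst.
by apply/funext => x; rewrite diff_lin.
Qed.

Lemma Cn_onD V W n (A : set V) (f g : V -> W) : open A ->
  Cn_on n A f -> Cn_on n A g -> Cn_on n A (fun x => f x + g x).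
Proof.
move=> oA; elim: n f g => [|n IH] f g /=.
  by move=> cf cg x Ax; apply: cvgD; [exact: cf | exact: cg].
move=> [df Cf] [dg Cg]; split=> [x Ax|v].
  by apply: differentiableD; [exact: df | exact: dg].
apply: eq_Cn_on (IH _ _ (Cf v) (Cg v)) => // x Ax.
exact/esym/(congr1 (fun h => h v) (diffD (df x Ax) (dg x Ax))).
Qed.

Lemma Cn_on_sum V W n (A : set V) (I : Type) (s : seq I) (f : I -> V -> W) :
  open A -> (forall i, Cn_on n A (f i)) ->
  Cn_on n A (fun x => \sum_(i <- s) f i x).
Proof.
move=> oA Cf; elim: s => [|i s IH].
  by under eq_fun do rewrite big_nil; exact: Cn_on_cst.
by under eq_fun do rewrite big_cons; exact: Cn_onD.
Qed.

Lemma Cn_onM V n (A : set V) (f g : V -> R) : open A ->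
  Cn_on n A f -> Cn_on n A g -> Cn_on n A (fun x => f x * g x).
Proof.
move=> oA; elim: n f g => [|n IH] f g.
  by move=> /= cf cg x Ax; apply: cvgM; [exact: cf | exact: cg].
move=> Cf Cg; have [[df df'] [dg dg']] := (Cf, Cg); split=> [x Ax|v].
  by apply: differentiableM; [exact: df | exact: dg].
have C' := Cn_onD oA (IH _ _ (Cn_onW Cf) (dg' v)) (IH _ _ (Cn_onW Cg) (df' v)).
apply: eq_Cn_on C' => // x Ax.
exact/esym/(congr1 (fun h => h v) (diffM (df x Ax) (dg x Ax))).
Qed.

Lemma Cn_onZl V W n (A : set V) (k : V -> R) (w : W) : open A ->
  Cn_on n A k -> Cn_on n A (fun x => k x *: w).
Proof.
move=> oA; elim: n k => [|n IH] k /=.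
  by move=> ck x Ax; apply: cvgZr_tmp; exact: ck.
move=> [dk Ck]; split=> [x Ax|v]; first by apply: differentiableZl; exact: dk.
apply: eq_Cn_on (IH _ (Ck v)) => // x Ax.
by rewrite (diffZl w (dk x Ax)).
Qed.

Lemma Cn_on_lin_comp V W W' n (A : set V) (L : {linear W -> W'}) (f : V -> W) :
  open A -> continuous L -> Cn_on n A f -> Cn_on n A (L \o f).
Proof.
move=> oA cL; elim: n f => [|n IH] f /=.
  by move=> cf x Ax; apply: continuous_comp; [exact: cf | exact: cL].
move=> [df Cf].
have dL x : differentiable L x by exact: linear_differentiable.
split=> [x Ax|v]; first by apply: differentiable_comp => //; exact: df.
apply: eq_Cn_on (IH _ (Cf v)) => // x Ax.
by rewrite (diff_comp (df x Ax) (dL _)) /= diff_lin.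
Qed.

(** A normed module carries no basis of its own, so finite dimension of E is
    expressed by vectors e i and continuous linear forms co i dual to them. *)
Definition linear_coordinates (E : normedModType R) (I : finType) (e : I -> E)
    (co : I -> {linear E -> R}) : Prop :=
  (forall i, continuous (co i)) /\ (forall x, x = \sum_i co i x *: e i).

Section Coordinates.
Context {E V : normedModType R} {I : finType} {e : I -> E}
  {co : I -> {linear E -> R}}.
Hypothesis coords : linear_coordinates e co.

Lemma Cn_on_coordinates n (A : set V) (f : V -> E) : open A ->
  (forall i, Cn_on n A (co i \o f)) -> Cn_on n A f.
Proof.
move=> oA Cf.
have C' := Cn_on_sum (index_enum I) oA (fun i => Cn_onZl (e i) oA (Cf i)).
by apply: eq_Cn_on C' => // x _; rewrite [RHS](coords.2).
Qed.

(** The derivative y |-> 'd g (f y) ('d f y v) of a composite is not a composite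
    with a fixed direction, so induction on n does not apply to it directly.
    Splitting 'd f y v along the coordinates writes it as a sum of products of
    scalar functions co i ('d f y v) and 'd g (f y) (e i), to which the
    induction hypothesis and stability under products apply. *)
Lemma Cn_on_comp n (A : set V) (B : set E) (f : V -> E) (g : E -> R) :
  open A -> (forall x, A x -> B (f x)) ->
  Cn_on n A f -> Cn_on n B g -> Cn_on n A (g \o f).
Proof.
move=> oA AB; elim: n g => [|n IH] g.
  by move=> /= cf cg x Ax; apply: continuous_comp; [exact: cf | apply/cg/AB].
move=> Cf Cg; have [[df df'] [dg dg']] := (Cf, Cg).
split=> [x Ax|v]; first by apply: differentiable_comp; [exact: df | apply/dg/AB].
have C' i := Cn_onM oA (Cn_on_lin_comp oA (coords.1 i) (df' v))
                       (IH _ (Cn_onW Cf) (dg' (e i))).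
apply: eq_Cn_on (Cn_on_sum (index_enum I) oA C') => // x Ax.
rewrite (diff_comp (df x Ax) (dg _ (AB _ Ax))) /=.
rewrite [in RHS](coords.2 ('d f x v)) linear_sum.
by apply: eq_bigr => i _; rewrite linearZ.
Qed.

End Coordinates.

End CnTheory.

(** * Coordinates and partial gradients on phase space *)

Section PhaseSpace.
Context {R : realType} {N : nat}.
Local Notation E := ('rV[R]_N * 'rV[R]_N)%type.

(** Naming the entry function lets it carry its linear structure. *)
Definition row_coord (i : 'I_N) (x : 'rV[R]_N) : R := x 0 i.

Fact row_coord_is_linear i : linear (row_coord i).
Proof. by move=> a x y; rewrite /row_coord !mxE. Qed.

HB.instance Definition _ i :=
  GRing.isLinear.Build R 'rV[R]_N R _ (row_coord i) (row_coord_is_linear i).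

Lemma row_coord_continuous i : continuous (row_coord i).
Proof. exact: coord_continuous. Qed.

Definition phase_coord (i : 'I_N + 'I_N) : {linear E -> R} :=
  match i with
  | inl j => row_coord j \o fst
  | inr j => row_coord j \o snd
  end.

Definition phase_basis (i : 'I_N + 'I_N) : E :=
  match i with
  | inl j => (delta_mx 0 j, 0)
  | inr j => (0, delta_mx 0 j)
  end.

Lemma fst_continuous : continuous (fst : E -> 'rV[R]_N).
Proof. by move=> x; exact: cvg_fst. Qed.

Lemma snd_continuous : continuous (snd : E -> 'rV[R]_N).
Proof. by move=> x; exact: cvg_snd. Qed.

Lemma phase_basisl (a : 'rV[R]_N) :
  \sum_i a 0 i *: phase_basis (inl i) = (a, 0).
Proof.
rewrite [a in RHS]row_sum_delta; elim/big_rec2: _ => // i x y _ ->.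
by congr (_, _); rewrite /= scaler0 add0r.
Qed.

Lemma phase_basisr (a : 'rV[R]_N) :
  \sum_i a 0 i *: phase_basis (inr i) = (0, a).
Proof.
rewrite [a in RHS]row_sum_delta; elim/big_rec2: _ => // i x y _ ->.
by congr (_, _); rewrite /= scaler0 add0r.
Qed.

Lemma phase_coordinates : linear_coordinates phase_basis phase_coord.
Proof.
split=> [[i|i] x|x].
- by apply: (@continuous_comp _ _ _ fst (row_coord i));
    [exact: fst_continuous | apply: row_coord_continuous].
- by apply: (@continuous_comp _ _ _ snd (row_coord i));
    [exact: snd_continuous | apply: row_coord_continuous].
rewrite big_sumType /= phase_basisl phase_basisr.
by case: x => a b; congr (_, _); rewrite /= ?addr0 ?add0r.
Qed.

Lemma grad_qE (S : E -> R) z i : differentiable S z ->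
  grad_q S z 0 i = 'd S z (phase_basis (inl i)).
Proof.
case: z => a b dS; rewrite mxE -deriveE //.
apply: (congr1 (fun F : R -> R => lim (F @ 0^'))); apply/funext => h /=.
by congr (_ *: (S (_, _) - _)); rewrite /= scaler0 add0r.
Qed.

Lemma grad_pE (S : E -> R) z i : differentiable S z ->
  grad_p S z 0 i = 'd S z (phase_basis (inr i)).
Proof.
case: z => a b dS; rewrite mxE -deriveE //.
apply: (congr1 (fun F : R -> R => lim (F @ 0^'))); apply/funext => h /=.
by congr (_ *: (S (_, _) - _)); rewrite /= scaler0 add0r.
Qed.

Lemma diff_row_coord (V : normedModType R) (f : V -> 'rV[R]_N) i z u :
  differentiable f z -> 'd (fun y => f y 0 i) z u = 'd f z u 0 i.
Proof.
move=> df; have cl := row_coord_continuous (i := i).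
have dl := linear_differentiable (f z) cl.
rewrite -[LHS]/('d (row_coord i \o f) z u).
by rewrite (diff_comp df dl) /= diff_lin.
Qed.

End PhaseSpace.

(** * Flows with a generating function of mixed variables *)

Section GeneratingFunction.
Context {R : realType} {N : nat}.
Local Notation E := ('rV[R]_N * 'rV[R]_N)%type.
Context (S : E -> R) (U V : set E) (nextp : E -> 'rV[R]_N).
Context (oU : open U) (smoothS : smooth_on U S)
  (solves : solves_momentum S U V nextp).

(** The point (q_k, p_{k+1}) at which the gradients of S are taken. *)
Definition mixed_point (z : E) : E := (z.1, nextp z).

Definition generated_map (z : E) : E := (grad_p S (mixed_point z), nextp z).

Let oV : open V. Proof. by case: solves. Qed.

Let diffS z : U z -> differentiable S z.
Proof. by case: (smoothS 1) => + _; apply. Qed.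

Let diff_dS v z : U z -> differentiable (fun w => 'd S w v) z.
Proof. by case: (smoothS 2) => _ /(_ v)[+ _]; apply. Qed.

Let diff_nextp z : V z -> differentiable nextp z.
Proof. by case: solves => _ /(_ 1%N)[+ _] _; apply. Qed.

Lemma mixed_point_in z : V z -> U (mixed_point z).
Proof.
case: solves => _ _ /(_ z.1 z.2); rewrite -surjective_pairing => sol /sol.
by move=> /(_ (nextp z)) [_ /(_ erefl)[]].
Qed.

Lemma momentumE z i : V z -> z.2 0 i = 'd S (mixed_point z) (phase_basis (inl i)).
Proof.
move=> Vz; rewrite -grad_qE; last exact/diffS/mixed_point_in.
move: Vz; case: solves => _ _ /(_ z.1 z.2); rewrite -surjective_pairing => sol /sol.
by move=> /(_ (nextp z)) [_ /(_ erefl)[_ {1}->]].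
Qed.

Lemma generated_map_generates : smooth_on V generated_map ->
  generates_flow S U V generated_map.
Proof.
move=> sm; split=> // qk pk Vz qk1 pk1.
case: solves => _ _ /(_ qk pk Vz) sol; split=> [[Uz pE ->]|[-> ->]].
  by have -> : pk1 = nextp (qk, pk) by apply/sol.
by have [] := (sol (nextp (qk, pk))).2 erefl.
Qed.

Lemma smooth_mixed_point : smooth_on V mixed_point.
Proof.
move=> n; apply: (Cn_on_coordinates phase_coordinates) => // -[] i.
  exact: (Cn_on_lin n V (phase_coordinates.1 (inl i))).
apply: (Cn_on_lin_comp (L := row_coord i) (f := nextp)) => //.
  exact: row_coord_continuous.
by case: solves => _ + _; apply.
Qed.

Lemma smooth_generated_map : smooth_on V generated_map.
Proof.
move=> n; apply: (Cn_on_coordinates phase_coordinates) => // -[] i; last first.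
  exact: (Cn_on_lin_comp oV (phase_coordinates.1 (inr i)) (smooth_mixed_point n)).
have C := Cn_on_comp phase_coordinates oV mixed_point_in
  (smooth_mixed_point n) ((smoothS n.+1).2 (phase_basis (inr i))).
apply: eq_Cn_on C => // z Vz.
by rewrite /= /row_coord /= grad_pE //; exact/diffS/mixed_point_in.
Qed.

Let diff_mixed_point z u : V z ->
  'd mixed_point z u = (u.1, 'd nextp z u).
Proof.
move=> Vz; have df := @linear_differentiable _ _ _ fst z fst_continuous.
apply: etrans (congr1 (fun h => h u) (diff_pair df (diff_nextp Vz))) _ => /=.
by congr (_, _); rewrite diff_lin //; exact: fst_continuous.
Qed.

Let hess (z a b : E) : R := 'd (fun w => 'd S w a) z b.

Let hessC z a b : U z -> hess z a b = hess z b a.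
Proof.
move=> Uz; apply: diff2C; [|exact: diff_dS..].
have := open_nbhs_nbhs (conj oU Uz); apply: filterS => w; exact: diffS.
Qed.

Let diff_dS_mixed z v u : V z ->
  'd (fun y => 'd S (mixed_point y) v) z u =
  hess (mixed_point z) v ('d mixed_point z u).
Proof.
move=> Vz; have dm : differentiable mixed_point z := (smooth_mixed_point 1).1 z Vz.
have dS := diff_dS v (mixed_point_in Vz).
exact: (congr1 (fun h => h u) (diff_comp dm dS)).
Qed.

Let nearV (z : E) : V z -> \near z, V z.
Proof. by move=> Vz; apply: open_nbhs_nbhs. Qed.

Let diff_eq_on (W : normedModType R) (f g : E -> W) z u : V z ->
  (forall y, V y -> f y = g y) -> differentiable f z -> 'd f z u = 'd g z u.
Proof.
move=> Vz fg df; have [|_ ->//] := @near_eq_is_diff _ _ _ f g z _ df.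
by apply: filterS (nearV Vz).
Qed.

(** Every differential of a component of p or Q is a value of the Hessian B of
    S at the mixed point, and contracting with the components of q or P adds
    these values up by linearity.  What remains of the difference of the two
    forms is B(Psi' u, Psi' v) - B(Psi' v, Psi' u), with Psi = mixed_point. *)
Lemma generated_map_symplectic z u v : V z ->
  dp_wedge_dq (fun y => y.1) (fun y => y.2) z u v =
  dp_wedge_dq (fun y => (generated_map y).1) (fun y => (generated_map y).2) z u v.
Proof.
move=> Vz; have Uw := mixed_point_in Vz; set w := mixed_point z in Uw.
have dfst : differentiable (fst : E -> _) z.
  exact/linear_differentiable/fst_continuous.
have dsnd : differentiable (snd : E -> _) z.
  exact/linear_differentiable/snd_continuous.
have dm := (smooth_mixed_point 1).1 z Vz.
have dqE i t : 'd (fun y : E => y.1 0 i) z t = t.1 0 i.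
  by rewrite (diff_row_coord _ _ dfst) diff_lin //; exact: fst_continuous.
(* The component p_i agrees with a partial derivative of S on V only, hence
   the passage through equality on an open set. *)
have dpE i t : 'd (fun y : E => y.2 0 i) z t =
    hess w ('d mixed_point z t) (phase_basis (inl i)).
  (* hess w _ is linear in its last argument, so the fixed basis vector goes
     there, ready for summation over i. *)
  rewrite hessC //; apply: etrans (diff_dS_mixed _ _ Vz).
  apply: (diff_eq_on _ Vz).
    by move=> y Vy; exact: momentumE.
  exact: (differentiable_comp dsnd (differentiable_coord _ _ _)).
have dPE i t : 'd (fun y => (generated_map y).2 0 i) z t = 'd nextp z t 0 i.
  exact/diff_row_coord/diff_nextp.
have dQE i t : 'd (fun y => (generated_map y).1 0 i) z t =
    hess w ('d mixed_point z t) (phase_basis (inr i)).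
  rewrite hessC //; apply: etrans (diff_dS_mixed _ _ Vz).
  apply: esym; apply: (diff_eq_on _ Vz).
    by move=> y Vy; rewrite -grad_pE //; exact/diffS/mixed_point_in.
  exact: (differentiable_comp dm (diff_dS _ Uw)).
have hess_sum a (x : 'rV_N) (e : 'I_N -> E) :
    \sum_i hess w a (e i) * x 0 i = hess w a (\sum_i x 0 i *: e i).
  rewrite /hess; move: ('d _ w) => L.
  by rewrite linear_sum; apply: eq_bigr => i _; rewrite linearZ mulrC.
have hess_suml a x := etrans (hess_sum a x _) (congr1 (hess w a) (phase_basisl x)).
have hess_sumr a x := etrans (hess_sum a x _) (congr1 (hess w a) (phase_basisr x)).
have lhsE : dp_wedge_dq (fun y => y.1) (fun y => y.2) z u v =
    hess w ('d mixed_point z u) (v.1, 0) - hess w ('d mixed_point z v) (u.1, 0).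
  rewrite -!hess_suml -sumrB; apply: eq_bigr => i _.
  by congr (_ * _ - _ * _); [exact: dpE|exact: dqE|exact: dpE|exact: dqE].
have rhsE : dp_wedge_dq (fun y => (generated_map y).1)
      (fun y => (generated_map y).2) z u v =
    hess w ('d mixed_point z v) (0, 'd nextp z u)
    - hess w ('d mixed_point z u) (0, 'd nextp z v).
  rewrite -!hess_sumr -sumrB; apply: eq_bigr => i _.
  rewrite [X in X - _ = _]mulrC [X in _ - X = _]mulrC.
  by congr (_ * _ - _ * _); [exact: dQE|exact: dPE|exact: dQE|exact: dPE].
rewrite lhsE rhsE.
have splitm a t : hess w a ('d mixed_point z t) =
    hess w a (t.1, 0) + hess w a (0, 'd nextp z t).
  rewrite diff_mixed_point // /hess -linearD.
  by congr ('d _ _ _); congr (_, _); rewrite /= ?addr0 ?add0r.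
have := hessC ('d mixed_point z u) ('d mixed_point z v) Uw.
by rewrite !splitm; lra.
Qed.

End GeneratingFunction.

Theorem proposition3p2 (R : realType) (N K s r : nat)
  (alpha t0 t1 : R) (Z : R -> 'rV[R]_K) (ZZ : R -> R -> 'M[R]_K)
  (halpha : 3^-1 < alpha <= 2^-1) (ht : t0 < t1)
  (hZ : geometric_rough_path alpha t0 t1 Z ZZ)
  (tk tk1 : R) (htk : t0 <= tk) (hstep : tk < tk1) (htk1 : tk1 <= t1)
  (H : 'rV[R]_N * 'rV[R]_N -> R) (HH : 'rV[R]_N * 'rV[R]_N -> 'rV[R]_K)
  (hH : smooth_on [set: 'rV[R]_N * 'rV[R]_N] H)
  (hHH : smooth_on [set: 'rV[R]_N * 'rV[R]_N] HH)
  (d : 'I_s.+1 -> R) (hd : control_points d)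
  (c b bbar : 'I_r -> R) (hc : quadrature_points c)
  (U V : set ('rV[R]_N * 'rV[R]_N)) (W : set (internal R N s r))
  (sol : 'rV[R]_N * 'rV[R]_N -> internal R N s r)
  (nextp : 'rV[R]_N * 'rV[R]_N -> 'rV[R]_N) :
  let F := galerkin_action H HH d c b bbar (tk1 - tk) (increment Z tk tk1) in
  let S_d := stationary_value F sol in
  solvable_by F U W sol ->
  smooth_on U S_d ->
  solves_momentum S_d U V nextp ->
  exists Phi : 'rV[R]_N * 'rV[R]_N -> 'rV[R]_N * 'rV[R]_N,
    generates_flow S_d U V Phi /\
    forall z, V z -> forall u v,
      dp_wedge_dq (fun y => y.1) (fun y => y.2) z u v =
      dp_wedge_dq (fun y => (Phi y).1) (fun y => (Phi y).2) z u v.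
Proof.
move=> F S_d [oU _ _ _] smoothS solves.
exists (generated_map S_d nextp); split.
  exact/generated_map_generates/smooth_generated_map.
by move=> z Vz u v; exact: (generated_map_symplectic oU smoothS solves).
Qed.
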